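(* Let $K$ be a field and let $n\ge 1$, $d\ge 0$ be integers. Let $I=(f_j)_{j\in J}\subset K[X_1,\dots,X_n]$ be an ideal generated by a (possibly infinite) family of polynomials with $\deg f_j\le d$ for all $j\in J$. Then $\mu(I)\le\binom{n+d-1}{d}$, and moreover $I$ can be generated by at most $\binom{n+d-1}{d}$ polynomials all of which have degree at most $d$. This bound is sharp for every choice of $K,n,d$: for every field $K$ and all integers $n\ge1$, $d\ge0$ there exists an ideal $I\subset K[X_1,\dots,X_n]$ generated by polynomials of degree at most $d$ with $\mu(I)=\binom{n+d-1}{d}$.
   Context: For an ideal $I$ of $K[X_1,\dots,X_n]$, $\mu(I)$ denotes the minimal possible number of elements in a generating set of $I$ (the generators need not belong to any originally given generating family). Degree means total degree; the zero polynomial is regarded as having degree at most $d$ for every $d \geq 0$. *)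

(* Defs.v *)
From mathcomp Require Import all_boot all_order all_algebra.
From mathcomp Require Import boolp classical_sets.
From mathcomp Require Import mpoly.

Set Implicit Arguments.
Unset Strict Implicit.
Unset Printing Implicit Defensive.

Import GRing.Theory.
Local Open Scope ring_scope.
Local Open Scope classical_set_scope.

(* [idealr_closed] of ring_quotient is not used here: it only describes proper
   ideals, and only decidable ones. *)
Definition is_ideal (R : comNzRingType) (I : set R) : Prop :=
  [/\ I 0,
      forall x y, I x -> I y -> I (x + y)
    & forall a x, I x -> I (a * x)].

Definition ideal_gen (R : comNzRingType) (S : set R) : set R :=
  smallest (@is_ideal R) S.

Definition has_generating_set (R : comNzRingType) (I : set R) (m : nat) : Prop :=
  exists s : seq R, [/\ uniq s, size s = m & I = ideal_gen [set` s]].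

(* The graph of mu: [is_mu I m] says that mu(I) is finite and equal to m. No
   such m exists when I is not finitely generated. *)
Definition is_mu (R : comNzRingType) (I : set R) (m : nat) : Prop :=
  has_generating_set I m /\
  forall k, has_generating_set I k -> (m <= k)%N.

(* [msize p] is one more than the total degree of p, and [msize 0 = 0]. *)
Definition mdeg_le (K : fieldType) (n d : nat) (p : {mpoly K[n]}) : Prop :=
  (msize p <= d.+1)%N.

(* Main.v *)
Require Import Defs.
From mathcomp Require Import all_boot all_order all_algebra.
From mathcomp Require Import boolp classical_sets.
From mathcomp Require Import mpoly.

(** Fix the degree-compatible order degrevlex and let [I] be generated in degree
at most [d]. For every monomial [w] of degree [d], among the nonzero elements of
[I] of degree at most [d] whose leading monomial is [w / X_0^a] for some [a],
pick one with [a] maximal. If [f] in [I] is nonzero of degree at most [d], then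
[w := X_0^(d - deg f) lm(f)] has degree [d] and the element picked for [w] has a
leading monomial dividing [lm(f)]; so the division algorithm reduces [f] to [0]
and the picked elements generate [I].

For sharpness take the ideal generated by all monomials of degree [d]. On
polynomials without terms of degree less than [d], multiplication by [a] acts on
the degree-[d] coefficients as the scalar [a(0)]; hence the degree-[d] parts of
any generating set span the space of all forms of degree [d]. *)

Set Implicit Arguments.
Unset Strict Implicit.
Unset Printing Implicit Defensive.

Import Order.TTheory GRing.Theory.
Local Open Scope ring_scope.
Local Open Scope classical_set_scope.

Section Ideals.
Variables (R : comNzRingType).
Implicit Types (S I : set R) (x y a : R).

Lemma ideal_gen_ideal S : is_ideal (ideal_gen S).
Proof.
split=> [A [[]]//|x y Sx Sy A idSA|a x Sx A idSA]; have [[_ AD AM] _] := idSA.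
  by apply: AD; [exact: Sx idSA | exact: Sy idSA].
exact/AM/(Sx _ idSA).
Qed.

Lemma sub_ideal_gen S : S `<=` ideal_gen S.
Proof. exact: sub_smallest. Qed.

Lemma ideal_gen_sub S I : is_ideal I -> S `<=` I -> ideal_gen S `<=` I.
Proof. exact: smallest_sub. Qed.

Lemma is_ideal_subr I x y : is_ideal I -> I x -> I y -> I (x - y).
Proof. by case=> _ ID IM Ix Iy; apply: ID; rewrite // -mulN1r; apply: IM. Qed.

Lemma ex_is_mu I (s : seq R) : I = ideal_gen [set` s] ->
  exists2 m, is_mu I m & (m <= size s)%N.
Proof.
move=> Is; have gs : has_generating_set I (size (undup s)).
  exists (undup s); split=> //; first exact: undup_uniq.
  by rewrite Is; congr ideal_gen; apply/seteqP; split=> x /=; rewrite mem_undup.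
have gI : exists k, `[< has_generating_set I k >].
  by exists (size (undup s)); apply/asboolP.
have [m /asboolP gm minm] := ex_minnP gI; exists m.
  by split=> // k gk; apply/minm/asboolP.
by apply: leq_trans (size_undup s); apply/minm/asboolP.
Qed.

End Ideals.

(** A monomial of degree [d] is encoded by the sorted tuple of its [d] variable indices. *)
Definition monomials (n d : nat) : seq 'X_{1..n} :=
  [seq s2m t | t : d.-tuple _ <- enum (basis n d)].

Lemma mem_monomials n d (m : 'X_{1..n}) : (m \in monomials n d) = (mdeg m == d).
Proof. by rewrite basis_cover. Qed.

Lemma size_monomials n d : (0 < n)%N -> size (monomials n d) = 'C(n + d - 1, d).
Proof.
by case: n => // n _; rewrite size_basis; congr 'C(_, d); rewrite addSn subn1 addnC.
Qed.

Section UpperBound.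
Variables (K : fieldType) (n d : nat).
Implicit Types (I : set {mpoly K[n.+1]}) (f g : {mpoly K[n.+1]}).

(** The monomials [w / X_0^a] form a chain under divisibility, so the one with the largest [a]
    divides all the others; [a] is bounded by the degree of [w]. *)
Lemma ex_least_mlead I (w : 'X_{1..n.+1}) : is_ideal I ->
  exists g, [/\ I g, mdeg_le d g &
    forall f a, I f -> f != 0 -> mdeg_le d f ->
      w = (mlead f + U_(ord0) *+ a)%MM ->
      g != 0 /\ (mlead g <= mlead f)%MM].
Proof.
move=> [I0 _ _].
pose P a := `[< exists f, [/\ I f, f != 0, mdeg_le d f &
  w = (mlead f + U_(ord0) *+ a)%MM] >].
have bP a : P a -> (a <= mdeg w)%N.
  move=> /asboolP[f [_ _ _ ->]].
  by rewrite mdegD mdegMn mdeg1 mul1n leq_addl.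
have [exP|nP] := pselect (exists a, P a); last first.
  (* With no candidate for [w], the zero polynomial fills its slot. *)
  exists 0; split=> //; first by rewrite /mdeg_le msize0.
  by move=> f a If f0 df wE; case: nP; exists a; apply/asboolP; exists f.
have [b /asboolP[g [Ig g0 dg wg]] maxb] := ex_maxnP exP bP.
exists g; split=> // f a If f0 df wf; split=> //.
have leab : (a <= b)%N by apply/maxb/asboolP; exists f.
suff -> : mlead f = (mlead g + U_(ord0) *+ (b - a))%MM by apply: lem_addr.
apply/mnmP => i; move/mnmP/(_ i): wg; rewrite wf !mnmDE !mulmnE mulnBr.
by move=> E; apply: (@addIn (U_(ord0)%MM i * a)); rewrite -addnA subnK ?leq_mul.
Qed.

Lemma ideal_le_generators I : is_ideal I ->
  exists s : seq {mpoly K[n.+1]},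
    [/\ size s = size (monomials n.+1 d),
        forall p, p \in s -> I p /\ mdeg_le d p
      & forall f, I f -> mdeg_le d f -> ideal_gen [set` s] f].
Proof.
move=> idI; have [g gP] := choice (fun w => ex_least_mlead w idI).
exists [seq g w | w <- monomials n.+1 d]; split; first by rewrite size_map.
  by move=> p /mapP[w _ ->]; have [? ? _] := gP w.
set s := [seq _ | _ <- _]; have [s0 sD sM] := ideal_gen_ideal [set` s].
elim/mleadrect=> f IHf If df; have [->//|f0] := eqVneq f 0.
have dlf : (mdeg (mlead f) <= d)%N by rewrite -ltnS mlead_deg.
pose w := (mlead f + U_(ord0) *+ (d - mdeg (mlead f)))%MM.
have dw : mdeg w = d by rewrite mdegD mdegMn mdeg1 mul1n subnKC.
have [Ig dg /(_ _ _ If f0 df erefl)[g0 legf]] := gP w.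
have sg : ideal_gen [set` s] (g w).
  by apply: sub_ideal_gen; apply: map_f; rewrite mem_monomials dw.
(* One division step: [q] is the multiple of [g w] with the leading term of [f]. *)
pose q := (mleadc f / mleadc (g w)) *: 'X_[(mlead f - mlead (g w))] * g w.
have lcg : mleadc (g w) != 0 by rewrite mleadc_eq0.
have lcf : mleadc f != 0 by rewrite mleadc_eq0.
have c0 : mleadc f / mleadc (g w) != 0 by rewrite mulf_neq0 ?invr_eq0.
have x0 : 'X_[(mlead f - mlead (g w))] != 0 :> {mpoly K[n.+1]}.
  by rewrite -msize_poly_eq0 msizeX.
have lq : mlead q = mlead f.
  by rewrite mleadM ?scaler_eq0 ?negb_or ?c0 // mleadZ // mleadXm submK.
have lcq : mleadc q = mleadc f.
  rewrite lq /q -scalerAl mcoeffZ [_ * g w]mulrC.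
  by rewrite -[X in (g w * _)@_X](submK legf) mcoeffMX divfK.
have q0 : q != 0 by rewrite -mleadc_eq0 lcq.
have Iq : I q by case: idI => _ _; apply.
have sq : ideal_gen [set` s] q by apply: sM.
rewrite -[f](subrK q); apply: sD => //.
(* The leading monomial of 0 is 1 by convention, which is no drop if [f] is constant. *)
have [->//|r0] := eqVneq (f - q) 0.
have /andP[nle le_r] : (mlead (f - q) != mlead f) && (mlead (f - q) <= mlead f)%O.
  rewrite (le_trans (mleadB_le _ _)) ?lq ?joinxx // andbT.
  apply: contra_neq r0 => lr; apply/eqP.
  by rewrite -mleadc_eq0 lr mcoeffB -{2}lq lcq subrr.
apply: IHf; first by rewrite lt_neqAle nle le_r.
  exact: is_ideal_subr.
(* Degree compatibility of the order keeps the remainder in degree at most [d]. *)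
by rewrite /mdeg_le -mlead_deg // ltnS (leq_trans (lemc_mdeg le_r)).
Qed.

End UpperBound.

Section Sharpness.
Variables (K : fieldType) (n d : nat).
Implicit Types (p a : {mpoly K[n]}).

Definition order_ge : set {mpoly K[n]} :=
  [set p | forall m, (mdeg m < d)%N -> p@_m = 0].

(** In [(a - a(0)) * p] a nonconstant monomial of the first factor leaves degree below [d] for the
    second, where [p] has no terms. *)
Lemma mcoeffM_order_ge a p (m : 'X_{1..n}) : order_ge p -> (mdeg m <= d)%N ->
  (a * p)@_m = a@_0%MM * p@_m.
Proof.
move=> p0 dm; rewrite -[a in LHS](subrK (a@_0%MM)%:MP) mulrDl mcoeffD mcoeffCM.
rewrite mcoeffM big1 ?add0r // => -[k1 k2] /= /eqP mE.
have [->|k0] := eqVneq (k1 : 'X_{1..n}) 0%MM.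
  by rewrite mcoeffB mcoeffC eqxx mulr1 subrr mul0r.
rewrite [_@_(bmnm k2)]p0 ?mulr0 //; apply: leq_trans dm.
by rewrite [X in (_ < mdeg X)%N]mE mdegD -[X in (X < _)%N]add0n ltn_add2r lt0n mdeg_eq0.
Qed.

Lemma order_ge_ideal : is_ideal order_ge.
Proof.
split=> [m _|p q p0 q0 m dm|a p p0 m dm]; first by rewrite mcoeff0.
  by rewrite mcoeffD p0 // q0 // addr0.
by rewrite (mcoeffM_order_ge _ p0) ?(ltnW dm) // p0 // mulr0.
Qed.

Let ms := monomials n d.
Let coefs p : 'rV[K]_(size ms) := \row_(j < size ms) p@_(nth 0%MM ms j).

Lemma leq_size_generators_max_power (s : seq {mpoly K[n]}) :
  ideal_gen (range (fun j : 'I_(size ms) => 'X_[nth 0%MM ms j]))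
    = ideal_gen [set` s] ->
  (size ms <= size s)%N.
Proof.
set I := ideal_gen (range _) => Is.
have dms (j : 'I_(size ms)) : mdeg (nth 0%MM ms j) = d.
  by apply/eqP; rewrite -mem_monomials mem_nth.
have sub : I `<=` order_ge.
  apply: ideal_gen_sub order_ge_ideal _ => _ [j _ <-] m dm.
  by rewrite mcoeffX; case: eqP dm => // <-; rewrite dms ltnn.
pose A := \matrix_(i < size s) coefs (nth 0 s i).
(* Since multiplication by [a] scales degree-[d] parts by [a(0)], membership of these parts in the
   row space of [A] cuts out an ideal. *)
pose T := [set p | order_ge p /\ (coefs p <= A)%MS].
have [o0 oD oM] := order_ge_ideal.
have idT : is_ideal T.
  split=> [|p q [op Ap] [oq Aq]|a p [op Ap]]; split.
  - exact: o0.
  - by rewrite (_ : coefs 0 = 0) ?sub0mx //; apply/rowP => j; rewrite !mxE mcoeff0.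
  - exact: oD.
  - rewrite (_ : coefs (p + q) = coefs p + coefs q) ?addmx_sub //.
    by apply/rowP => j; rewrite !mxE mcoeffD.
  - exact: oM.
  - rewrite (_ : coefs (a * p) = a@_0%MM *: coefs p) ?scalemx_sub //.
    by apply/rowP => j; rewrite !mxE mcoeffM_order_ge ?dms.
have subT : I `<=` T.
  rewrite Is; apply: ideal_gen_sub idT _ => p /= ps; split.
    (* The arbitrary generators in [s] have no low-degree terms because they lie in [I]. *)
    by apply: sub; rewrite Is; apply: sub_ideal_gen.
  have ips : (index p s < size s)%N by rewrite index_mem.
  by apply/(eq_row_sub (Ordinal ips)); rewrite rowK /= nth_index.
(* The degree-[d] monomials give the unit rows, so [A] has full column rank, at most its number of
   rows. *)
have : ((1%:M : 'M[K]_(size ms)) <= A)%MS.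
  apply/row_subP => j; have [_] : T 'X_[nth 0%MM ms j].
    by apply: subT; apply: sub_ideal_gen; exists j.
  congr (_ <= _)%MS; apply/rowP => k.
  rewrite !mxE mcoeffX nth_uniq ?uniq_basis //.
by move/mxrankS; rewrite mxrank1 => /leq_trans; apply; apply: rank_leq_row.
Qed.

End Sharpness.

Theorem theorem1p1 (K : fieldType) (n d : nat) (n_ge1 : (1 <= n)%N) :
  (forall (J : Type) (f : J -> {mpoly K[n]}),
     (forall j, mdeg_le d (f j)) ->
     (exists m : nat,
        is_mu (ideal_gen (range f)) m /\ (m <= 'C(n + d - 1, d))%N)
     /\
     (exists s : seq {mpoly K[n]},
        [/\ (size s <= 'C(n + d - 1, d))%N,
            forall p, p \in s -> mdeg_le d p
          & ideal_gen (range f) = ideal_gen [set` s]]))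
  /\
  (exists (J : Type) (f : J -> {mpoly K[n]}),
     (forall j, mdeg_le d (f j)) /\
     is_mu (ideal_gen (range f)) 'C(n + d - 1, d)).
Proof.
have gen (J : Type) (f : J -> {mpoly K[n]}) : (forall j, mdeg_le d (f j)) ->
    exists s : seq {mpoly K[n]},
      [/\ (size s <= 'C(n + d - 1, d))%N, forall p, p \in s -> mdeg_le d p
        & ideal_gen (range f) = ideal_gen [set` s]].
  (* The upper bound needs a variable [X_0]. *)
  case: n n_ge1 f => // n' _ f df.
  have [s [size_s sP sI]] := ideal_le_generators d (ideal_gen_ideal (range f)).
  exists s; split=> [|p /sP[]//|]; first by rewrite size_s size_monomials.
  apply/seteqP; split; apply: ideal_gen_sub; try exact: ideal_gen_ideal.
    by move=> _ [j _ <-]; apply: sI (df j); apply: sub_ideal_gen; exists j.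
  by move=> p /= /sP[].
have mu (J : Type) (f : J -> {mpoly K[n]}) : (forall j, mdeg_le d (f j)) ->
    exists2 m, is_mu (ideal_gen (range f)) m & (m <= 'C(n + d - 1, d))%N.
  move=> /gen[s [size_s _ /ex_is_mu[m mum lem]]].
  by exists m => //; apply: leq_trans size_s.
split=> [J f df|].
  by split; [have [m] := mu J f df; exists m | apply: gen].
pose f (j : 'I_(size (monomials n d))) : {mpoly K[n]} :=
  'X_[nth 0%MM (monomials n d) j].
have df j : mdeg_le d (f j).
  rewrite /mdeg_le msizeX ltnS.
  by rewrite (eqP (_ : mdeg _ == d)) // -mem_monomials mem_nth.
exists _, f; split=> //; have [m mum lem] := mu _ f df.
suff <- : m = 'C(n + d - 1, d) by [].
apply/eqP; rewrite eqn_leq lem -(size_monomials d n_ge1).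
by have [[s [_ <- /leq_size_generators_max_power]]] := mum.
Qed.
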